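(* Let $n$ be a positive integer and suppose that $M$ is an MOPLS($n$) (a maximal orthogonal partial Latin square of order $n$, in superimposed form) with $F$ filled cells. Then $F\ge n^2/3$, with equality if and only if every frequency in $M$ (that is, the frequency of every row, of every column, of every first entry symbol and of every second entry symbol) is equal to $n/3$.
   Context: A partial Latin square of order $n$, PLS($n$), is an $n\times n$ array, each of whose cells is either empty or filled with one element of a fixed $n$-element set of entries, such that each element of the entry set occurs at most once in every row and at most once in every column. Two partial Latin squares of the same order $n$ having the same filled cells as one another are orthogonal if, when superimposed, each of the $n^2$ possible ordered pairs (first entry, second entry) appears at most once in the cells of the superimposed square. An OPLS($n$) is the superimposed array of such a pair: an $n\times n$ array in which each cell is either empty or filled with an ordered pair (first entry, second entry), where first entries come from a fixed $n$-element set and second entries come from a fixed $n$-element set, such that each first entry symbol occurs at most once in each row and at most once in each column, likewise each second entry symbol, and each ordered pair of symbols occurs in at most one cell. An MOPLS($n$) is a maximal OPLS($n$), i.e. an OPLS($n$) that cannot be extended to another OPLS($n$) (with the same row, column, first entry and second entry sets) by inserting any entry pair into any empty cell. The frequency of a row (column) is the number of filled cells in that row (column). The frequency of a first entry symbol (second entry symbol) is the number of cells in which it appears as first (second) entry; symbols of the $n$-element entry sets that do not appear have frequency $0$. *)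

(* Defs.v *)
From mathcomp Require Import all_boot all_order all_algebra.

Set Implicit Arguments.
Unset Strict Implicit.
Unset Printing Implicit Defensive.

(* [None] is an empty cell. The entry set [E] is meant to have [n] elements;
   this is a hypothesis of the theorem. *)
Definition is_pls (n : nat) (E : finType) (L : 'M[option E]_n) : Prop :=
  (forall i j1 j2 e, L i j1 = Some e -> L i j2 = Some e -> j1 = j2) /\
  (forall j i1 i2 e, L i1 j = Some e -> L i2 j = Some e -> i1 = i2).

Section Superimposed.
Variables (n : nat) (E1 E2 : finType).
Implicit Type M : 'M[option (E1 * E2)]_n.

Definition first_square M : 'M[option E1]_n := map_mx (omap fst) M.
Definition second_square M : 'M[option E2]_n := map_mx (omap snd) M.

(* The two component squares have the same filled cells by construction. *)
Definition is_opls M : Prop :=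
  [/\ is_pls (first_square M),
      is_pls (second_square M) &
      forall i1 j1 i2 j2 p,
        M i1 j1 = Some p -> M i2 j2 = Some p -> i1 = i2 /\ j1 = j2].

Definition insert_pair M (r c : 'I_n) (p : E1 * E2) : 'M[option (E1 * E2)]_n :=
  \matrix_(i, j) if (i == r) && (j == c) then Some p else M i j.

Definition is_mopls M : Prop :=
  is_opls M /\
  forall r c p, M r c = None -> ~ is_opls (insert_pair M r c p).

Definition filled_cells M : nat := #|[set x : 'I_n * 'I_n | M x.1 x.2 != None]|.

Definition row_freq M (r : 'I_n) : nat := #|[set c | M r c != None]|.
Definition col_freq M (c : 'I_n) : nat := #|[set r | M r c != None]|.

Definition first_freq M (a : E1) : nat :=
  #|[set x : 'I_n * 'I_n | first_square M x.1 x.2 == Some a]|.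
Definition second_freq M (b : E2) : nat :=
  #|[set x : 'I_n * 'I_n | second_square M x.1 x.2 == Some b]|.

End Superimposed.

(* Main.v *)
Require Import Defs.
From mathcomp Require Import all_boot all_order all_algebra.
From mathcomp Require Import zify.

Set Implicit Arguments.
Unset Strict Implicit.
Unset Printing Implicit Defensive.

Import Order.TTheory GRing.Theory Num.Theory.
Local Open Scope ring_scope.

(** List each filled cell of [M] as a word (row, column, first entry, second
    entry) of length 4 over an [n]-letter alphabet. The conditions on an OPLS
    say that two distinct words agree in at most one coordinate, that is, the
    set [C] of words is a code of minimum distance at least 3. A pair [(a, b)]
    can be inserted in cell [(r, c)] exactly when the word [(r, c, a, b)] agrees
    with every codeword in at most one coordinate, so maximality says that every
    word agrees with some codeword in two coordinates: the covering radius of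
    [C] is at most 2. The four kinds of frequencies are the numbers of codewords
    with a given letter at a given coordinate, and the four coordinates now play
    symmetric roles.

    Let [m] be the least frequency, attained by letter [a] at coordinate [i].
    At any other coordinate, exactly [m] letters share a codeword with [(i, a)].
    Among the (coordinate, letter) pairs sharing no codeword with [(i, a)], let
    [(j, b)] have the least frequency [l] (if there are none, then [m = n] and
    [|C| >= n ^ 2]), and let [k], [k'] be the remaining
    coordinates. Split the letters [c] at [k] as follows:
    - [m] of them share a codeword with [(i, a)] and have frequency at least [m];
    - the other [n - m] have frequency at least [l] by the choice of [(j, b)],
      and at most [l] of them share a codeword with [(j, b)];
    - if [c] shares a codeword neither with [(i, a)] nor with [(j, b)], take any
      letter [d] at [k'] with the same property. The word made of [a], [b], [c],
      [d] agrees twice with some codeword, necessarily at [k] and [k']. There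
      are at least [n - m - l] such [d], so [c] has frequency at least
      [n - m - l] ([cover_complement]).
    Summing the frequencies at [k] gives [2 |C| >= 2 m^2 + (n - m)^2]
    ([card_code_min_star]), hence [6 |C| >= 2 n^2 + (3 m - n)^2]. This is the
    bound, and equality forces [m = n / 3]; all frequencies are then at least
    [n / 3] and average to [|C| / n = n / 3] at each coordinate, so they are all
    equal to [n / 3] ([code_bound]). *)

(** * Codes of length 4 *)

Section Codes.
Local Open Scope nat_scope.
Variables (n : nat) (C : {set 4.-tuple 'I_n}).
Implicit Types (w v : 4.-tuple 'I_n) (i j : 'I_4) (a b : 'I_n).

Definition star i a : {set 4.-tuple 'I_n} := [set w in C | tnth w i == a].

Definition shadow i a j : {set 'I_n} := [set tnth w j | w in star i a].

Definition min_dist3 : Prop := forall w w' i j, w \in C -> w' \in C -> i != j ->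
  tnth w i = tnth w' i -> tnth w j = tnth w' j -> w = w'.

Definition cover_radius2 : Prop := forall v, exists w i j,
  [/\ w \in C, i != j, tnth w i = tnth v i & tnth w j = tnth v j].

Lemma sum_card_star i : \sum_(a < n) #|star i a| = #|C|.
Proof.
rewrite -sum1_card (partition_big (fun w => tnth w i) xpredT) //=.
by apply: eq_bigr => a _; rewrite -sum1_card; apply: eq_bigl => w; rewrite inE.
Qed.

Lemma shadow_sym i a j b : (b \in shadow i a j) = (a \in shadow j b i).
Proof.
by apply/imsetP/imsetP => -[w]; rewrite inE => /andP[Cw /eqP <-] ->;
  exists w; rewrite // inE Cw eqxx.
Qed.

Lemma card_shadow (sepC : min_dist3) i a j : i != j -> #|shadow i a j| = #|star i a|.
Proof.
move=> ij; apply: card_in_imset => w w'; rewrite !inE.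
move=> /andP[Cw /eqP wa] /andP[Cw' /eqP w'a].
by apply: (sepC w w' i j Cw Cw' ij); rewrite wa.
Qed.

Lemma other_one i : exists j, i != j.
Proof. by have [->|] := eqVneq i ord0; [exists ord_max|exists ord0]. Qed.

Lemma other_two i j : i != j -> exists k k', [/\ k != k', k != i, k != j, k' != i &
  k' != j /\ forall x, x != i -> x != j -> x = k \/ x = k'].
Proof.
move=> ij; have: #|~: [set i; j]| == 2 by rewrite cardsCs setCK cards2 ij card_ord.
move=> /cards2P[k [k' [kk' E]]].
have inE2 x : (x \in [set k; k']) = (x != i) && (x != j).
  by rewrite -E !inE negb_or.
have := inE2 k; have := inE2 k'; rewrite !inE !eqxx orbT /=.
move=> /esym/andP[k'i k'j] /esym/andP[ki kj].
exists k, k'; split=> //; split=> // x xi xj.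
by have := inE2 x; rewrite xi xj !inE => /orP[]/eqP; [left|right].
Qed.

(** The word with letters [a], [b], [c], [d] at [i], [j], [k], [k'] can agree with
    a codeword neither at [i] nor at [j] together with another coordinate, since
    its other letters avoid the shadows of [(i, a)] and [(j, b)]. The two
    agreements that covering provides are therefore at [k] and [k']. *)
Lemma cover_complement i j k k' a b c d (covC : cover_radius2) :
    i != j -> k != k' -> k != i -> k != j -> k' != i -> k' != j ->
    (forall x, x != i -> x != j -> x = k \/ x = k') ->
    b \notin shadow i a j ->
    c \notin shadow i a k -> c \notin shadow j b k ->
    d \notin shadow i a k' -> d \notin shadow j b k' ->
  d \in shadow k c k'.
Proof.
move=> ij kk' ki kj k'i k'j rest nb nci ncj ndi ndj.
pose v := [tuple if x == i then a else if x == j then b else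
                 if x == k then c else d | x < 4].
have vi : tnth v i = a by rewrite tnth_mktuple eqxx.
have vj : tnth v j = b by rewrite tnth_mktuple eq_sym (negPf ij) eqxx.
have vk : tnth v k = c by rewrite tnth_mktuple (negPf ki) (negPf kj) eqxx.
have vk' : tnth v k' = d.
  by rewrite tnth_mktuple (negPf k'i) (negPf k'j) eq_sym (negPf kk').
have [w [x [y [Cw xy wx wy]]]] := covC v.
have agree p q : tnth w p = tnth v p -> tnth w q = tnth v q ->
    tnth v q \in shadow p (tnth v p) q.
  by move=> wp <-; apply: imset_f; rewrite inE Cw wp eqxx.
have noi q : q != i -> tnth v q \notin shadow i a q.
  move=> qi; have [->|qj] := eqVneq q j; first by rewrite vj.
  by case: (rest q qi qj) => ->; rewrite ?vk ?vk'.
have noj q : q != j -> tnth v q \notin shadow j b q.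
  move=> qj; have [->|qi] := eqVneq q i; first by rewrite vi -shadow_sym.
  by case: (rest q qi qj) => ->; rewrite ?vk ?vk'.
have outside p q : p != q -> tnth w p = tnth v p -> tnth w q = tnth v q ->
    p = k \/ p = k'.
  move=> pq wp wq; have A := agree _ _ wp wq; apply: rest; apply/eqP => ep.
    by move: A; rewrite ep vi (negPf (noi _ _)) // -ep eq_sym.
  by move: A; rewrite ep vj (negPf (noj _ _)) // -ep eq_sym.
have [wk wk'] : tnth w k = tnth v k /\ tnth w k' = tnth v k'.
  have yx : y != x by rewrite eq_sym.
  case: (outside _ _ xy wx wy) (outside _ _ yx wy wx) => ex [] ey;
    by move: xy wx wy; rewrite ex ey ?eqxx.
by have := agree _ _ wk wk'; rewrite vk vk'.
Qed.

Lemma leq_card_sum (P : pred 'I_n) (f : 'I_n -> nat) q :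
  (forall a, P a -> q <= f a) -> #|P| * q <= \sum_(a | P a) f a.
Proof. by move=> le; rewrite -sum_nat_const; apply: leq_sum. Qed.

(** The right-hand side is least when [q] is the larger of [l] and [s + t - l]. If
    that is [l], then [l >= (s + t) / 2] and the sum is [(s + t) l]. Otherwise
    [q >= l], so decreasing [s] at constant [s + t] only increases the sum, and
    at [s = l] it is [l ^ 2 + (s + t - l) ^ 2 >= (s + t) ^ 2 / 2]. *)
Lemma leq_sqr_split s t l q :
  s <= l -> l <= q -> s + t - l <= q -> (s + t) ^ 2 <= 2 * (s * l + t * q).
Proof.
move=> /subnKC <-; set u := l - s => lq dq; rewrite -mulnn.
have [/subnKC|/ltnW/subnKC] := leqP t (s + 2 * u).
  set e := _ - t => te; have tq : t * (s + u) <= t * q by rewrite leq_mul2l lq orbT.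
  have : (s + t) * (s + 2 * u) = (s + t) * (t + e) by rewrite te.
  nia.
set e := t - _ => te.
have tq : t * (s + u + e) <= t * q by rewrite leq_mul2l; apply/orP; right; lia.
rewrite -te in tq *; nia.
Qed.

(** The count of codewords by their letter at a coordinate [k], where the letters
    are split according to whether they share a codeword with a letter of least
    frequency, or with a letter of least frequency among those not meeting it. *)
Lemma card_code_min_star (n_gt0 : 0 < n) (sepC : min_dist3) (covC : cover_radius2) :
  exists i a, (forall j b, #|star i a| <= #|star j b|) /\
    2 * #|star i a| ^ 2 + (n - #|star i a|) ^ 2 <= 2 * #|C|.
Proof.
pose a0 := Ordinal n_gt0.
pose f (x : 'I_4 * 'I_n) := #|star x.1 x.2|.
have [[i a] _ min_ia] := @arg_minnP _ (ord0, a0) xpredT f isT.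
have {}min_ia j b : #|star i a| <= #|star j b| by apply: (min_ia (j, b)).
exists i, a; split=> //; set m := #|star i a| in min_ia *.
pose free (x : 'I_4 * 'I_n) := (x.1 != i) && (x.2 \notin shadow i a x.1).
have [[j0 b0] free0|nofree] := pickP free; last first.
  (* Every letter meets [(i, a)], so [m = n] and [|C| >= n ^ 2]. *)
  have [j ij] := other_one i.
  have full : shadow i a j = setT.
    apply/setP=> b; rewrite inE; have := nofree (j, b).
    by rewrite /free /= eq_sym ij /= => /negbFE.
  have mn : m = n by rewrite -[m](card_shadow sepC _ ij) full cardsT card_ord.
  have := @leq_card_sum xpredT (fun a => #|star i a|) m (fun b _ => min_ia i b).
  rewrite sum_card_star card_ord; lia.
have [[j b] /= /andP[/= ji nb] min_jb] := @arg_minnP _ (j0, b0) free f free0.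
set l := f (j, b) in min_jb.
have ij : i != j by rewrite eq_sym.
have [k [k' [kk ki kj k'i [k'j kall]]]] := other_two ij.
have [ik jk ik' jk'] : [/\ i != k, j != k, i != k' & j != k'].
  by rewrite ![_ == k]eq_sym ![_ == k']eq_sym.
pose S := shadow i a k; pose S' := shadow j b k.
have cardS : #|S| = m by apply: card_shadow.
have cardS' : #|S'| = l by apply: card_shadow.
pose q := maxn l (n - m - l).
pose P1 := [pred c | (c \notin S) && (c \in S')].
pose P2 := [pred c | (c \notin S) && (c \notin S')].
have cS : m * m <= \sum_(c | c \in S) #|star k c|.
  by rewrite -[X in X * _]cardS; apply: leq_card_sum => c _; apply: min_ia.
have lS c : c \notin S -> l <= #|star k c|.
  by move=> cS'; apply: (min_jb (k, c)); rewrite /free /= ki.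
have c1 : #|P1| * l <= \sum_(c | P1 c) #|star k c|.
  by apply: leq_card_sum => c /andP[/lS].
have c2 : #|P2| * q <= \sum_(c | P2 c) #|star k c|.
  apply: leq_card_sum => c /andP[cnS cnS'].
  rewrite geq_max lS //=.
  rewrite -(card_shadow sepC c kk).
  (* [c] occurs with every letter at [k'] that meets neither [(i, a)] nor [(j, b)]. *)
  have sub : ~: (shadow i a k' :|: shadow j b k') \subset shadow k c k'.
    apply/subsetP=> d; rewrite !inE negb_or => /andP[di dj].
    exact: (@cover_complement i j k k' a b c d covC).
  apply: leq_trans (subset_leq_card sub).
  rewrite [leqRHS]cardsCs setCK card_ord -subnDA leq_sub2l //.
  by apply: leq_trans (leq_card_setU _ _) _; rewrite !card_shadow.
have total : m + (#|P1| + #|P2|) = n.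
  rewrite -cardS -[RHS]card_ord -(cardC (mem S)); congr (_ + _).
  rewrite -(cardID (mem S') [predC S]); congr (_ + _); apply: eq_card => c;
  by rewrite !inE // andbC.
have s1 : #|P1| <= l.
  by rewrite -cardS'; apply/subset_leq_card/subsetP => c /andP[].
rewrite -(sum_card_star k) (bigID (mem S)) /=.
rewrite [\sum_(c | c \notin S) _](bigID (mem S')) /=.
have nm : n - m = #|P1| + #|P2| by rewrite -[X in X - m]total addKn.
have sq : (n - m) ^ 2 <= 2 * (#|P1| * l + #|P2| * q).
  by rewrite nm leq_sqr_split // ?leq_maxl // -nm leq_maxr.
apply: leq_trans (leq_add (leqnn _) sq) _.
by rewrite -mulnDr leq_mul2l /= -mulnn; apply: leq_add cS (leq_add c1 c2).
Qed.

(** The hypothesis amounts to [2 p ^ 2 + (3 m - p) ^ 2 <= 6 c]; with [d = p - m] the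
    square is [(2 m - d) ^ 2], whence the inequality between [2 m] and [d]. *)
Lemma third_of_bound p m c :
  m <= p -> 2 * m ^ 2 + (p - m) ^ 2 <= 2 * c ->
  p ^ 2 <= 3 * c /\ (3 * c = p ^ 2 -> 3 * m = p).
Proof.
move=> /subnKC <-; set d := p - m; rewrite addKn => bound.
have [gap gap_eq] := nat_Cauchy (2 * m) d.
split=> [|eqc]; first by rewrite -!mulnn in bound gap *; lia.
suff /eqP : 2 * m == d by lia.
by rewrite -gap_eq eqn_leq gap /=; rewrite -!mulnn in bound eqc *; lia.
Qed.

(** In the equality case the least frequency is [n / 3], so that every frequency
    is at least its average at the given coordinate, hence equal to it. *)
Theorem code_bound (n_gt0 : 0 < n) (sepC : min_dist3) (covC : cover_radius2) :
  n ^ 2 <= 3 * #|C| /\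
  (3 * #|C| = n ^ 2 -> forall i a, 3 * #|star i a| = n).
Proof.
have [i0 [a0 [min_m]]] := card_code_min_star n_gt0 sepC covC.
set m := #|star i0 a0| in min_m * => bound.
have m_le_n : m <= n.
  have [j ij] := other_one i0.
  by rewrite -[m](card_shadow sepC _ ij) -[leqRHS]card_ord max_card.
have [le3C eq3m] := third_of_bound m_le_n bound.
split=> // eqC i a; have m3 := eq3m eqC.
have le3 b : true -> n <= 3 * #|star i b| ?= iff (n == 3 * #|star i b|).
  by move=> _; split=> //; rewrite -[leqLHS]m3 leq_pmul2l // min_m.
have [_] := leqif_sum le3.
rewrite -big_distrr /= sum_card_star sum_nat_const card_ord eqC eqxx.
by move/esym/forallP/(_ a)/eqP.
Qed.

End Codes.

(** * Inserting an entry *)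

Section Insertion.
Variables (n : nat) (E : finType).
Implicit Type L : 'M[option E]_n.

(** This is [insert_pair] for a single alphabet, so that both component squares
    of an insertion are insertions. *)
Definition insert_entry L (r c : 'I_n) (e : E) : 'M[option E]_n :=
  \matrix_(i, j) if (i == r) && (j == c) then Some e else L i j.

Lemma insert_pls L r c e : is_pls L ->
  (forall j, L r j <> Some e) -> (forall i, L i c <> Some e) ->
  is_pls (insert_entry L r c e).
Proof.
move=> [rowL colL] new_row new_col; split=> [i j1 j2 x|j i1 i2 x]; rewrite !mxE.
- have [->|_] := eqVneq i r; last exact: rowL.
  have [->|_] := eqVneq j1 c; have [->|_] := eqVneq j2 c => //=.
  + by move=> [<-] /new_row.
  + by move=> Lx [ex]; case: (new_row j1); rewrite Lx ex.
  + exact: rowL.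
- have [->|_] := eqVneq j c; last by rewrite !andbF; apply: colL.
  have [->|_] := eqVneq i1 r; have [->|_] := eqVneq i2 r => //=.
  + by move=> [<-] /new_col.
  + by move=> Lx [ex]; case: (new_col i1); rewrite Lx ex.
  + exact: colL.
Qed.

End Insertion.

Lemma insert_opls (n : nat) (E1 E2 : finType) (M : 'M[option (E1 * E2)]_n) r c x y :
    is_opls M ->
    (forall i j x' y', M i j = Some (x', y') ->
      [/\ ~ (i = r /\ x' = x), ~ (i = r /\ y' = y), ~ (j = c /\ x' = x),
          ~ (j = c /\ y' = y) & ~ (x' = x /\ y' = y)]) ->
  is_opls (insert_pair M r c (x, y)).
Proof.
move=> [pls1 pls2 pairs] far; split.
- have -> : first_square (insert_pair M r c (x, y)) =
            insert_entry (first_square M) r c x.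
    by apply/matrixP=> i j; rewrite !mxE; case: ifP.
  apply: insert_pls => // [j|i]; rewrite mxE.
    by case Mrj: (M r j) => [[x' y']|//] [ex]; have [[]] := far _ _ _ _ Mrj.
  by case Mic: (M i c) => [[x' y']|//] [ex]; have [_ _ []] := far _ _ _ _ Mic.
- have -> : second_square (insert_pair M r c (x, y)) =
            insert_entry (second_square M) r c y.
    by apply/matrixP=> i j; rewrite !mxE; case: ifP.
  apply: insert_pls => // [j|i]; rewrite mxE.
    by case Mrj: (M r j) => [[x' y']|//] [ey]; have [_ []] := far _ _ _ _ Mrj.
  by case Mic: (M i c) => [[x' y']|//] [ey]; have [_ _ _ []] := far _ _ _ _ Mic.
- move=> i1 j1 i2 j2 [x' y']; rewrite !mxE.
  case: (boolP ((i1 == r) && (j1 == c))) => [/andP[/eqP -> /eqP ->]|_];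
  case: (boolP ((i2 == r) && (j2 == c))) => [/andP[/eqP -> /eqP ->]|_] //=.
  + by move=> [<- <-] M2; have [_ _ _ _ []] := far _ _ _ _ M2.
  + by move=> M1 [ex ey]; have [_ _ _ _ []] := far _ _ _ _ M1.
  + exact: pairs.
Qed.

(** * The code of a superimposed square *)

Section CodeOfSquare.
Local Open Scope nat_scope.
Variables (n : nat) (E1 E2 : finType) (M : 'M[option (E1 * E2)]_n).
Variables (g1 : 'I_n -> E1) (g2 : 'I_n -> E2).
Hypotheses (g1_bij : bijective g1) (g2_bij : bijective g2).
Implicit Type w : 4.-tuple 'I_n.

Definition irow : 'I_4 := @Ordinal 4 0 isT.
Definition icol : 'I_4 := @Ordinal 4 1 isT.
Definition ifst : 'I_4 := @Ordinal 4 2 isT.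
Definition isnd : 'I_4 := @Ordinal 4 3 isT.

Lemma coordP (i : 'I_4) : [\/ i = irow, i = icol, i = ifst | i = isnd].
Proof.
by case: i => [[|[|[|[|//]]]]] h; [apply: Or41|apply: Or42|apply: Or43|apply: Or44];
  apply: val_inj.
Qed.

(** The bijections [g1] and [g2] rename the entry sets to ['I_n], so that all four
    coordinates have the same alphabet. *)
Definition code : {set 4.-tuple 'I_n} :=
  [set w | M (tnth w irow) (tnth w icol) ==
           Some (g1 (tnth w ifst), g2 (tnth w isnd))].

Definition cell w : 'I_n * 'I_n := (tnth w irow, tnth w icol).

Lemma codeP w : reflect
  (M (tnth w irow) (tnth w icol) = Some (g1 (tnth w ifst), g2 (tnth w isnd)))
  (w \in code).
Proof. by rewrite inE; apply: eqP. Qed.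

Lemma filled_word r c a b :
  M r c = Some (g1 a, g2 b) -> [tuple r; c; a; b] \in code.
Proof. by move=> Mrc; apply/codeP. Qed.

Lemma filledE r c : M r c != None -> exists a b, M r c = Some (g1 a, g2 b).
Proof.
have [h1 _ h1K] := g1_bij; have [h2 _ h2K] := g2_bij.
case: (M r c) => [[x y]|//] _.
by exists (h1 x), (h2 y); rewrite h1K h2K.
Qed.

Lemma cell_inj : {in code &, injective cell}.
Proof.
move=> w w' /codeP Mw /codeP Mw' [er ec].
move: Mw; rewrite er ec Mw' => -[/(bij_inj g1_bij) ea /(bij_inj g2_bij) eb].
by apply: eq_from_tnth => i; case: (coordP i) => ->.
Qed.

(** Two agreements between codewords, whichever they are, put both codewords in
    the same cell: each of the six pairs of coordinates is one of the uniqueness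
    conditions on an OPLS. *)
Lemma code_min_dist3 : is_opls M -> min_dist3 code.
Proof.
move=> [[f_row f_col] [s_row s_col] pairs] w w' i j Cw Cw'.
have /codeP Mw := Cw; have /codeP Mw' := Cw'.
suff key : forall p q : 'I_4, p < q -> tnth w p = tnth w' p ->
    tnth w q = tnth w' q -> cell w = cell w'.
  move=> ij wi wj; apply: cell_inj => //.
  have [ltij|ltji|/val_inj eij] := ltngtP i j.
  - exact: key ltij wi wj.
  - exact: key ltji wj wi.
  - by rewrite eij eqxx in ij.
rewrite /cell => p q.
case: (coordP p) => ->; case: (coordP q) => -> // _ ep eq.
- by rewrite ep eq.
- rewrite ep; congr (_, _); apply: (f_row (tnth w' irow) _ _ (g1 (tnth w' ifst))).
    by rewrite mxE -ep Mw /= eq.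
  by rewrite mxE Mw'.
- rewrite ep; congr (_, _); apply: (s_row (tnth w' irow) _ _ (g2 (tnth w' isnd))).
    by rewrite mxE -ep Mw /= eq.
  by rewrite mxE Mw'.
- rewrite ep; congr (_, _); apply: (f_col (tnth w' icol) _ _ (g1 (tnth w' ifst))).
    by rewrite mxE -ep Mw /= eq.
  by rewrite mxE Mw'.
- rewrite ep; congr (_, _); apply: (s_col (tnth w' icol) _ _ (g2 (tnth w' isnd))).
    by rewrite mxE -ep Mw /= eq.
  by rewrite mxE Mw'.
- rewrite ep eq in Mw.
  by have [-> ->] := pairs _ _ _ _ _ Mw Mw'.
Qed.

(** A word agreeing with each codeword in at most one coordinate describes an
    empty cell, in which its entry pair could be inserted. *)
Lemma code_cover_radius2 : is_mopls M -> cover_radius2 code.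
Proof.
move=> [oM maxM] v.
pose agree w i j := [&& w \in code, i != j, tnth w i == tnth v i & tnth w j == tnth v j].
suff /existsP[w /existsP[i /existsP[j /and4P[Cw ij /eqP wi /eqP wj]]]] :
  [exists w, exists i, exists j, agree w i j] by exists w, i, j.
apply: contraT => far.
have {}far w i j : ~~ agree w i j.
  by apply: contra far => A; apply/existsP; exists w; apply/existsP; exists i;
    apply/existsP; exists j.
have Mv : M (tnth v irow) (tnth v icol) = None.
  apply/eqP/negPn/negP=> /filledE[a [b /filled_word Cw]].
  have := far [tuple tnth v irow; tnth v icol; a; b] irow icol.
  by rewrite /agree Cw !eqxx.
case: (maxM _ _ (g1 (tnth v ifst), g2 (tnth v isnd)) Mv).
apply: insert_opls => // i j x y Mij.
have [a [b Mab]] : exists a b, M i j = Some (g1 a, g2 b).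
  by apply: filledE; rewrite Mij.
have Cw := filled_word Mab.
have {}far p q : p != q -> tnth [tuple i; j; a; b] p = tnth v p ->
    tnth [tuple i; j; a; b] q = tnth v q -> False.
  by move=> pq wp wq; have := far [tuple i; j; a; b] p q;
    rewrite /agree Cw pq wp wq !eqxx.
move: Mab; rewrite Mij => -[-> ->].
split=> -[].
- by move=> e1 /(bij_inj g1_bij) e2; exact: (far irow ifst).
- by move=> e1 /(bij_inj g2_bij) e2; exact: (far irow isnd).
- by move=> e1 /(bij_inj g1_bij) e2; exact: (far icol ifst).
- by move=> e1 /(bij_inj g2_bij) e2; exact: (far icol isnd).
- by move=> /(bij_inj g1_bij) e1 /(bij_inj g2_bij) e2; exact: (far ifst isnd).
Qed.

Lemma filled_cells_code : filled_cells M = #|code|.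
Proof.
rewrite -(card_in_imset cell_inj); apply: eq_card => -[r c].
rewrite inE; apply/idP/imsetP => /= [/filledE[a [b /filled_word Cw]]|].
  by exists [tuple r; c; a; b].
by move=> [w /codeP Mw [-> ->]]; rewrite Mw.
Qed.

(** A cell of row [r] is given by its column, so the filled cells of the row
   correspond to a shadow. *)
Lemma row_freq_code (oM : is_opls M) r : row_freq M r = #|star code irow r|.
Proof.
rewrite -(@card_shadow _ _ (code_min_dist3 oM) irow r icol) //.
apply: eq_card => c; rewrite inE; apply/idP/imsetP.
  move=> /filledE[a [b /filled_word Cw]].
  by exists [tuple r; c; a; b]; rewrite // inE Cw /=.
by move=> [w /setIdP[/codeP Mw /eqP <-] ->]; rewrite Mw.
Qed.

Lemma col_freq_code (oM : is_opls M) c : col_freq M c = #|star code icol c|.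
Proof.
rewrite -(@card_shadow _ _ (code_min_dist3 oM) icol c irow) //.
apply: eq_card => r; rewrite inE; apply/idP/imsetP.
  move=> /filledE[a [b /filled_word Cw]].
  by exists [tuple r; c; a; b]; rewrite // inE Cw /=.
by move=> [w /setIdP[/codeP Mw /eqP <-] ->]; rewrite Mw.
Qed.

Lemma card_cell_star i a : #|[set cell w | w in star code i a]| = #|star code i a|.
Proof.
by apply: card_in_imset => w w' /setIdP[Cw _] /setIdP[Cw' _]; apply: cell_inj.
Qed.

Lemma first_freq_code a : first_freq M (g1 a) = #|star code ifst a|.
Proof.
rewrite -card_cell_star; apply: eq_card => -[r c]; rewrite inE mxE /=.
apply/idP/imsetP => [Ma|[w /setIdP[/codeP Mw /eqP <-] [-> ->]]]; last by rewrite Mw.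
have [|a' [b Mab]] := @filledE r c; first by case: (M r c) Ma.
exists [tuple r; c; a'; b] => //; rewrite inE filled_word //=.
by move: Ma; rewrite Mab /= => /eqP[/(bij_inj g1_bij) ->].
Qed.

Lemma second_freq_code b : second_freq M (g2 b) = #|star code isnd b|.
Proof.
rewrite -card_cell_star; apply: eq_card => -[r c]; rewrite inE mxE /=.
apply/idP/imsetP => [Mb|[w /setIdP[/codeP Mw /eqP <-] [-> ->]]]; last by rewrite Mw.
have [|a [b' Mab]] := @filledE r c; first by case: (M r c) Mb.
exists [tuple r; c; a; b'] => //; rewrite inE filled_word //=.
by move: Mb; rewrite Mab /= => /eqP[/(bij_inj g2_bij) ->].
Qed.

End CodeOfSquare.

Lemma ord_bij (n : nat) (E : finType) : #|E| = n -> {g : 'I_n -> E | bijective g}.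
Proof. by move=> <-; exists enum_val; apply: enum_val_bij. Qed.

Lemma eq_div3 (x y : nat) : x%:R = y%:R / 3 :> rat <-> (3 * x)%N = y.
Proof.
split=> [e|<-]; last by rewrite natrM mulrC mulKf.
by apply/eqP; rewrite -(eqr_nat rat) natrM e mulrC divfK.
Qed.

Theorem theorem2p1 (n : nat) (E1 E2 : finType) (M : 'M[option (E1 * E2)]_n)
    (n_gt0 : (0 < n)%N) (cardE1 : #|E1| = n) (cardE2 : #|E2| = n)
    (maxM : is_mopls M) :
  (n%:R ^+ 2 / 3 <= (filled_cells M)%:R :> rat) /\
  ((filled_cells M)%:R = n%:R ^+ 2 / 3 :> rat <->
   [/\ forall r : 'I_n, (row_freq M r)%:R = n%:R / 3 :> rat,
       forall c : 'I_n, (col_freq M c)%:R = n%:R / 3 :> rat,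
       forall a : E1, (first_freq M a)%:R = n%:R / 3 :> rat &
       forall b : E2, (second_freq M b)%:R = n%:R / 3 :> rat]).
Proof.
have [g1 g1_bij] := ord_bij cardE1.
have [g2 g2_bij] := ord_bij cardE2.
have [oM _] := maxM.
have sepC := code_min_dist3 g1_bij g2_bij oM.
have covC := code_cover_radius2 g1_bij g2_bij maxM.
have [le3 eq3] := code_bound n_gt0 sepC covC.
rewrite -natrX (filled_cells_code M g1_bij g2_bij); split.
  by rewrite ler_pdivrMr // -natrM ler_nat mulnC.
rewrite eq_div3; split=> [/eq3 all3|[row3 _ _ _]].
  split=> [r|c|a|b]; apply/eq_div3.
  - by rewrite (row_freq_code g1_bij g2_bij).
  - by rewrite (col_freq_code g1_bij g2_bij).
  - by have [h _ hK] := g1_bij; rewrite -[a]hK (first_freq_code M g1_bij g2_bij).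
  - by have [h _ hK] := g2_bij; rewrite -[b]hK (second_freq_code M g1_bij g2_bij).
rewrite -(sum_card_star _ irow) big_distrr /=.
rewrite (eq_bigr (fun=> n)) ?sum_nat_const ?card_ord ?mulnn // => r _.
by rewrite -(row_freq_code g1_bij g2_bij) //; apply/eq_div3.
Qed.
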